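(* Let $R$ be a solvable complex Leibniz algebra whose nilradical $N$ is isomorphic to one of $g^3_{(n,1)}$ ($n\ge7$), $g^1_7$, $g^2_9$, $g^3_{11}$, and with $\dim R=\dim N+1$. Then $R$ has a basis $\{e_1,\dots,e_m,x\}$ ($m=\dim N$) in which $\{e_1,\dots,e_m\}$ spans $N$ with the brackets of the corresponding algebra, and the brackets involving $x$ are as follows (all others involving $x$, including $[x,x]$, being zero): for $N=g^3_{(n,1)}$: $[e_1,x]=-[x,e_1]=e_1$, $[e_i,x]=-[x,e_i]=(i+1)e_i$ for $2\le i\le n-1$, $[e_n,x]=-[x,e_n]=2e_n$; for $N=g^1_7$: $[e_i,x]=-[x,e_i]=ie_i$, $1\le i\le7$; for $N=g^2_9$: $[e_i,x]=-[x,e_i]=ie_i$, $1\le i\le 9$; for $N=g^3_{11}$: $[e_i,x]=-[x,e_i]=ie_i$, $1\le i\le 11$.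
   Context: A Leibniz algebra is a complex vector space with a bilinear bracket satisfying $[u,[v,w]]=[[u,v],w]-[[u,w],v]$; solvable, nilpotent and nilradical (maximal nilpotent ideal) are defined via the derived and lower central series as usual. The following are Lie algebras; only listed brackets of basis elements and their antisymmetric counterparts are nonzero. $g^3_{(n,1)}$ ($n\ge7$), basis $e_1,\dots,e_n$: $[e_1,e_i]=e_{i+1}$ ($2\le i\le n-2$); $[e_i,e_n]=e_{i+2}$ ($2\le i\le n-3$); $[e_2,e_i]=e_{i+3}$ ($3\le i\le n-4$). $g^1_7$: $[e_1,e_i]=e_{i+1}$ ($2\le i\le 5$); $[e_2,e_i]=e_{i+2}$ ($3\le i\le 4$); $[e_i,e_{7-i}]=(-1)^ie_7$ ($2\le i\le 3$). $g^2_9$: $[e_1,e_i]=e_{i+1}$ ($2\le i\le 7$); $[e_2,e_i]=e_{i+2}$ ($3\le i\le 4$); $[e_2,e_5]=3e_7$; $[e_2,e_6]=5e_8$; $[e_3,e_i]=-2e_{i+3}$ ($4\le i\le5$); $[e_i,e_{9-i}]=(-1)^ie_9$ ($2\le i\le 4$). $g^3_{11}$: $[e_1,e_i]=e_{i+1}$ ($2\le i\le 9$); $[e_2,e_i]=e_{i+2}$ ($3\le i\le 4$); $[e_2,e_i]=-e_{i+2}$ ($6\le i\le 7$); $[e_3,e_7]=-e_{10}$; $[e_3,e_i]=e_{i+3}$ ($4\le i\le 5$); $[e_4,e_i]=e_{i+4}$ ($5\le i\le 6$); $[e_i,e_{11-i}]=(-1)^ie_{11}$ ($2\le i\le 5$).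 *)

(* Defs.v *)
(* The complex field is  R[i]  for an arbitrary  R : realType
   (real-closed's  complex R ; every realType is a model of the reals). *)
From HB Require Import structures.
From mathcomp Require Import all_boot all_order all_algebra complex.
From mathcomp Require Import reals.
Set Implicit Arguments. Unset Strict Implicit. Unset Printing Implicit Defensive.
Import Order.TTheory GRing.Theory Num.Theory.
Local Open Scope ring_scope.

Section Leibniz.
Variables (K : fieldType) (V : vectType K) (br : V -> V -> V).

Definition bilinear_br : Prop :=
  (forall u, linear (br u)) /\ (forall v, linear (fun u => br u v)).

Definition leibniz_identity : Prop :=
  forall u v w, br u (br v w) = br (br u v) w - br (br u w) v.

Definition leibniz_algebra : Prop := bilinear_br /\ leibniz_identity.

(* [U, W] : the subspace spanned by all brackets [u, w], u in U, w in W
   (by bilinearity it is spanned by brackets of basis vectors). *)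
Definition brs (U W : {vspace V}) : {vspace V} :=
  (\sum_(u <- vbasis U) \sum_(w <- vbasis W) <[br u w]>)%VS.

Definition ideal (I : {vspace V}) : Prop :=
  forall u v, u \in I -> br u v \in I /\ br v u \in I.

Fixpoint derived (k : nat) : {vspace V} :=
  if k is k'.+1 then brs (derived k') (derived k') else fullv.

Definition solvable_alg : Prop := exists k, derived k = 0%VS.

Fixpoint lcs (N : {vspace V}) (k : nat) : {vspace V} :=
  if k is k'.+1 then brs (lcs N k') N else N.

Definition nilpotent_sub (N : {vspace V}) : Prop := exists k, lcs N k = 0%VS.

Definition nilradical (N : {vspace V}) : Prop :=
  [/\ ideal N, nilpotent_sub N &
      forall I, ideal I -> nilpotent_sub I -> (N <= I)%VS -> I = N].

(* A multiplication table: Entry i j k a  means  [e_i, e_j] = a e_k, with the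
   antisymmetric counterpart [e_j, e_i] = - a e_k; all other brackets of basis
   vectors are zero. *)
Record entry := Entry { ei : nat; ej : nat; ek : nat; ea : K }.

Definition table_br (L : seq entry) (e : nat -> V) (i j : nat) : V :=
  \sum_(t <- L)
     (if (ei t == i) && (ej t == j) then ea t *: e (ek t)
      else if (ei t == j) && (ej t == i) then - (ea t *: e (ek t)) else 0).

Definition has_table_basis (N : {vspace V}) (m : nat) (L : seq entry)
  (e : nat -> V) : Prop :=
  basis_of N [seq e i | i <- iota 1 m] /\
  forall i j, (1 <= i <= m)%N -> (1 <= j <= m)%N -> br (e i) (e j) = table_br L e i j.

End Leibniz.

Inductive nilalg := G3n1 of nat | G1_7 | G2_9 | G3_11.

Definition nilalg_ok (g : nilalg) : bool :=
  if g is G3n1 n then (7 <= n)%N else true.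

Definition nildim (g : nilalg) : nat :=
  match g with G3n1 n => n | G1_7 => 7 | G2_9 => 9 | G3_11 => 11 end.

Definition nil_table (K : fieldType) (g : nilalg) : seq (entry K) :=
  match g with
  | G3n1 n =>
      [seq Entry 1 i i.+1 1 | i <- iota 2 (n - 3)]
   ++ [seq Entry i n (i + 2) 1 | i <- iota 2 (n - 4)]
   ++ [seq Entry 2 i (i + 3) 1 | i <- iota 3 (n - 6)]
  | G1_7 =>
      [seq Entry 1 i i.+1 1 | i <- iota 2 4]
   ++ [seq Entry 2 i (i + 2) 1 | i <- iota 3 2]
   ++ [seq Entry i (7 - i) 7 ((-1) ^+ i) | i <- iota 2 2]
  | G2_9 =>
      [seq Entry 1 i i.+1 1 | i <- iota 2 6]
   ++ [seq Entry 2 i (i + 2) 1 | i <- iota 3 2]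
   ++ [:: Entry 2 5 7 3%:R; Entry 2 6 8 5%:R]
   ++ [seq Entry 3 i (i + 3) (- 2%:R) | i <- iota 4 2]
   ++ [seq Entry i (9 - i) 9 ((-1) ^+ i) | i <- iota 2 3]
  | G3_11 =>
      [seq Entry 1 i i.+1 1 | i <- iota 2 8]
   ++ [seq Entry 2 i (i + 2) 1 | i <- iota 3 2]
   ++ [seq Entry 2 i (i + 2) (-1) | i <- iota 6 2]
   ++ [:: Entry 3 7 10 (-1)]
   ++ [seq Entry 3 i (i + 3) 1 | i <- iota 4 2]
   ++ [seq Entry 4 i (i + 4) 1 | i <- iota 5 2]
   ++ [seq Entry i (11 - i) 11 ((-1) ^+ i) | i <- iota 2 4]
  end.

(* the eigenvalue of ad-action of x on e_i:  [e_i, x] = w_i e_i *)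
Definition x_weight (K : fieldType) (g : nilalg) (i : nat) : K :=
  match g with
  | G3n1 n => if i == 1 then 1 else if i == n then 2%:R else i.+1%:R
  | _ => i%:R
  end.

(* Main.v *)
(* In each of these algebras N the basis can be indexed by weight: f_1, ..., f_m
   with [f_p, f_q] a multiple of f_(p+q). The brackets force every derivation of
   N to have no component of negative degree and to be a multiple of the weight
   in degree 0. Pick y outside N and let a be this multiple for u |-> [u, y].
   If a = 0, then right multiplication by any element raises the filtration by
   weight, so the whole algebra is nilpotent, against the maximality of N.
   Otherwise x = y / a acts triangularly on the right with the distinct
   eigenvalues 1, ..., m; its eigenvectors have the same brackets as the f_k,
   since the eigenspaces are lines and the leading terms are known. Finally
   [x, f_k] + [f_k, x] and [x, x] lie in N and annihilate from the right, and
   such an element is 0: its components along non-central f_k vanish, and each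
   other f_k is a product, which gives [x, f_k] = - k f_k. *)
Require Import Defs.
From HB Require Import structures.
From mathcomp Require Import all_boot all_order all_algebra complex.
From mathcomp Require Import reals.
From mathcomp Require Import boolp zify ring.
Import GRing.Theory Num.Theory.
Local Open Scope ring_scope.

Set Implicit Arguments.
Unset Strict Implicit.

(** * Coordinates in a basis numbered from 1 *)

(** Every natural number indexes a linear form on the whole of [V], zero out of range, so that
    shifted indices can be written uniformly later on. *)
Lemma basis_coordinates (K : fieldType) (V : vectType K) (N : {vspace V})
    (m : nat) (f : nat -> V) :
  basis_of N [seq f k | k <- iota 1 m] ->
  exists co : nat -> {scalar V},
    [/\ forall u, u \in N -> u = \sum_(1 <= k < m.+1) co k u *: f k,
        forall j k, (0 < k <= m)%N -> co j (f k) = (k == j)%:R &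
        forall j u, ~~ (0 < j <= m)%N -> co j u = 0].
Proof.
pose s : m.-tuple V := [tuple of [seq f k | k <- iota 1 m]].
rewrite -[map _ _]/(tval s) => Bf.
have nthS i : (i < m)%N -> s`_i = f i.+1.
  by move=> lt_im; rewrite (nth_map 0%N) ?size_iota// nth_iota// add1n.
(* The predecessor passes from 1..m to ordinals. The test [0 < j] excludes 0, which truncation would
   confuse with 1. *)
pose cf j u := if insub j.-1 is Some i then
  (if (0 < j)%N then coord s (i : 'I_m) u else 0) else 0.
have cf_lin j : scalar (cf j).
  move=> a u v; rewrite /cf; case: insub => [i|]; last by rewrite mulr0 addr0.
  by case: ifP => _; [rewrite linearP | rewrite mulr0 addr0].
exists (fun j => HB.pack_for {scalar V} (cf j)
  (GRing.isLinear.Build K V K *%R (cf j) (cf_lin j))).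
have cfS (i : 'I_m) u : cf i.+1 u = coord s i u by rewrite /cf /= valK.
split=> /=.
- move=> u Nu; rewrite [LHS](coord_basis Bf Nu) big_add1 /= big_mkord.
  by apply: eq_bigr => i _; rewrite cfS nthS.
- move=> j [|k] // lt_km; rewrite /cf.
  case: insubP => [i lt_i def_i|]; last first.
    by case: eqP => // <-; rewrite /= (lt_km : (k < m)%N).
  case: j def_i {lt_i} => [|j] //= def_i.
  rewrite -nthS// eqSS -def_i -[k]/(val (Ordinal (lt_km : (k < m)%N))).
  by rewrite coord_free ?(basis_free Bf)// eq_sym.
by case=> [|j] u; rewrite /cf /=; [case: insub | case: insubP => // i ->].
Qed.

(** * Bracket calculus in a Leibniz algebra *)

Section LeibnizCalculus.
Variables (K : fieldType) (V : vectType K) (br : V -> V -> V).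
Hypothesis brL : leibniz_algebra br.

Lemma brDl u u' v : br (u + u') v = br u v + br u' v.
Proof. by have := brL.1.2 v 1 u u'; rewrite !scale1r. Qed.

Lemma brDr u v v' : br u (v + v') = br u v + br u v'.
Proof. by have := brL.1.1 u 1 v v'; rewrite !scale1r. Qed.

Lemma br0l v : br 0 v = 0.
Proof. by apply: (addrI (br 0 v)); rewrite -brDl !addr0. Qed.

Lemma br0r u : br u 0 = 0.
Proof. by apply: (addrI (br u 0)); rewrite -brDr !addr0. Qed.

Lemma brZl a u v : br (a *: u) v = a *: br u v.
Proof. by have := brL.1.2 v a u 0; rewrite !addr0 br0l addr0. Qed.

Lemma brZr a u v : br u (a *: v) = a *: br u v.
Proof. by have := brL.1.1 u a v 0; rewrite !addr0 br0r addr0. Qed.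

Lemma brBl u u' v : br (u - u') v = br u v - br u' v.
Proof. by rewrite -scaleN1r brDl brZl scaleN1r. Qed.

Lemma br_suml (I : Type) (r : seq I) (P : pred I) (F : I -> V) v :
  br (\sum_(i <- r | P i) F i) v = \sum_(i <- r | P i) br (F i) v.
Proof. exact: (big_morph (br^~ v) (fun u w => brDl u w v) (br0l v)). Qed.

Lemma br_sumr (I : Type) (r : seq I) (P : pred I) (F : I -> V) u :
  br u (\sum_(i <- r | P i) F i) = \sum_(i <- r | P i) br u (F i).
Proof. exact: (big_morph (br u) (fun v w => brDr u v w) (br0r u)). Qed.

Lemma br_derivation u v w : br (br u v) w = br u (br v w) + br (br u w) v.
Proof. by rewrite brL.2 subrK. Qed.

Lemma br_square_r u v : br u (br v v) = 0.
Proof. by rewrite brL.2 subrr. Qed.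

Lemma br_symmetrized_r u v w : br u (br v w + br w v) = 0.
Proof. by rewrite brDr !brL.2 subrKA subrr. Qed.

Lemma brs_ind (P : V -> Prop) (U W : {vspace V}) :
  P 0 -> (forall u v, P u -> P v -> P (u + v)) ->
  (forall a u, P u -> P (a *: u)) ->
  (forall u w, u \in U -> w \in W -> P (br u w)) ->
  forall v, v \in brs br U W -> P v.
Proof.
move=> P0 PD PZ Pbr; rewrite /brs big_seq.
pose Q (S : {vspace V}) := forall v, v \in S -> P v.
have Q0 : Q 0%VS by move=> v; rewrite memv0 => /eqP->.
have QD S T : Q S -> Q T -> Q (S + T)%VS.
  by move=> QS QT v /memv_addP[s Ss [t Tt ->]]; apply: PD; [apply: QS | apply: QT].
apply: (big_ind Q) => // u Uu; rewrite big_seq; apply: (big_ind Q) => // w Ww.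
move=> v /vlineP[a ->]; apply/PZ/Pbr; exact: vbasis_mem.
Qed.

(** Write [y, y] = n + b y. Since [y, [y, y]] = 0, the multiple b [y, y] = - [y, n] lies in [N]. If
    b is nonzero this suffices; if b = 0, then [y, y] = n. *)
Lemma square_in_codim1_ideal (N : {vspace V}) y :
  ideal br N -> (forall v, exists n b, n \in N /\ v = n + b *: y) ->
  br y y \in N.
Proof.
move=> idN spanV; set z := br y y.
have [n [b [Nn zE]]] := spanV z.
have bzN : b *: z \in N.
  have -> : b *: z = - br y n.
    apply/eqP; rewrite -addr_eq0 addrC -brZr -brDr -zE; apply/eqP.
    exact: br_square_r.
  by rewrite rpredN; exact: (idN n y Nn).2.
by move: bzN; rewrite rpredZeq zE => /orP[/eqP->|//]; rewrite scale0r addr0.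
Qed.

End LeibnizCalculus.

(** * Ideals with a basis graded by weight, and the filtration by weight *)

Section GradedBasis.
Variables (K : numFieldType) (V : vectType K) (br : V -> V -> V).
Hypothesis brL : leibniz_algebra br.
Variables (N : {vspace V}) (m : nat) (c : nat -> nat -> K) (f : nat -> V).
Hypothesis idN : ideal br N.
Hypothesis c_supp : forall p q, c p q != 0 -> [&& 0 < p, 0 < q & p + q <= m]%N.
Hypothesis c_anti : forall p q, c q p = - c p q.
Hypothesis f_basis : basis_of N [seq f k | k <- iota 1 m].
Hypothesis f_out : forall k, ~~ (0 < k <= m)%N -> f k = 0.
Hypothesis brf : forall p q, br (f p) (f q) = c p q *: f (p + q)%N.
Variable co : nat -> {scalar V}.
Hypothesis co_sum : forall u, u \in N -> u = \sum_(1 <= k < m.+1) co k u *: f k.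
Hypothesis co_f : forall j k, (0 < k <= m)%N -> co j (f k) = (k == j)%:R.
Hypothesis co_out : forall j u, ~~ (0 < j <= m)%N -> co j u = 0.

Lemma basis_vector_mem k : f k \in N.
Proof.
have [k_in|/f_out->] := boolP (0 < k <= m)%N; last exact: mem0v.
by apply: (basis_mem f_basis); rewrite map_f// mem_iota; lia.
Qed.

Lemma br_memr u v : v \in N -> br u v \in N.
Proof. by move=> Nv; case: (idN u Nv). Qed.

Lemma br_meml u v : u \in N -> br u v \in N.
Proof. by move=> Nu; case: (idN v Nu). Qed.

(** The truncated difference is 0 here, an index outside the support of [c]. This makes formulas in
    [c p (j - p)] valid for all [j]. *)
Lemma coef_truncated0 p j : (j <= p)%N -> c p (j - p) = 0.
Proof.
move=> le_jp; apply/eqP/negPn/negP => /c_supp.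
by rewrite (eqP (le_jp : j - p == 0)%N) andbF.
Qed.

Lemma big_nat_only (F : nat -> K) j :
  (forall k, (0 < k <= m)%N -> k != j -> F k = 0) ->
  (~~ (0 < j <= m)%N -> F j = 0) -> \sum_(1 <= k < m.+1) F k = F j.
Proof.
move=> F0 Fout; have [j_in|j_out] := boolP (0 < j <= m)%N.
  rewrite (bigD1_seq j) ?mem_index_iota ?iota_uniq//= big1_seq ?addr0//.
  by move=> k /andP[neq_kj]; rewrite mem_index_iota ltnS => /F0; apply.
rewrite Fout// big1_seq// => k /=; rewrite mem_index_iota ltnS => k_in.
by apply: F0 => //; apply: contraNneq j_out => <-.
Qed.

Lemma co_f_prod p q j : c p q * co j (f (p + q)%N) = c p q * (p + q == j)%N%:R.
Proof.
have [->|/c_supp c_pq] := eqVneq (c p q) 0; first by rewrite !mul0r.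
by rewrite co_f//; lia.
Qed.

Lemma co_fbr j p u : u \in N -> co j (br (f p) u) = c p (j - p) * co (j - p)%N u.
Proof.
move=> Nu; rewrite {1}(co_sum Nu) (br_sumr brL) raddf_sum /=.
rewrite (eq_bigr (fun k => co k u * (c p k * (p + k == j)%N%:R))); last first.
  by move=> k _; rewrite (brZr brL) linearZ brf linearZ /= co_f_prod.
rewrite (@big_nat_only _ (j - p)%N) => [|k k_in ne_k|/co_out->]; last by rewrite mul0r.
  have [le_jp|lt_pj] := leqP j p; first by rewrite coef_truncated0 ?mul0r ?mulr0.
  by rewrite subnKC ?eqxx ?mulr1 1?mulrC// ltnW.
case: eqP => [def_j|_]; last by rewrite !mulr0.
by case/eqP: ne_k; lia.
Qed.

Lemma co_br j u v : u \in N -> v \in N ->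
  co j (br u v) = \sum_(1 <= i < m.+1) co i u * (c i (j - i) * co (j - i)%N v).
Proof.
move=> Nu Nv; rewrite {1}(co_sum Nu) (br_suml brL) raddf_sum /=.
by apply: eq_bigr => i _; rewrite (brZl brL) linearZ /= co_fbr.
Qed.

Lemma br_anti u v : u \in N -> v \in N -> br v u = - br u v.
Proof.
move=> Nu Nv; rewrite (co_sum Nu) (co_sum Nv) !(br_suml brL) -sumrN.
under eq_bigr do rewrite (br_sumr brL).
under [RHS]eq_bigr do rewrite (br_sumr brL) -sumrN.
rewrite exchange_big; apply: eq_bigr => i _; apply: eq_bigr => j _.
rewrite !(brZl brL, brZr brL) !brf c_anti addnC scaleNr !scalerN !scalerA.
by rewrite (mulrC (co j v)).
Qed.

Lemma co_brf j q u : u \in N -> co j (br u (f q)) = co (j - q)%N u * c (j - q) q.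
Proof.
move=> Nu; rewrite (br_anti (basis_vector_mem q) Nu) linearN /= co_fbr//
  (c_anti (j - q)).
by rewrite mulNr opprK mulrC.
Qed.

Lemma coords_inj u v : u \in N -> v \in N -> (forall j, co j u = co j v) -> u = v.
Proof.
move=> Nu Nv eq_co; rewrite (co_sum Nu) (co_sum Nv).
by apply: eq_bigr => j _; rewrite eq_co.
Qed.

(** Elements of [N] whose components all have weight at least [s]. Steps 0 and 1 are both [N], and
    all steps beyond [m] are 0. *)
Definition filtration s u := u \in N /\ forall j, (j < s)%N -> co j u = 0.

Lemma filtration_add s u v : filtration s u -> filtration s v -> filtration s (u + v).
Proof.
move=> [Nu u0] [Nv v0]; split=> [|j lt_js]; first exact: rpredD.
by rewrite linearD /= u0 ?v0 ?addr0.
Qed.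

Lemma filtration_scale s a u : filtration s u -> filtration s (a *: u).
Proof.
move=> [Nu u0]; split=> [|j lt_js]; first exact: rpredZ.
by rewrite linearZ /= u0 ?mulr0.
Qed.

Lemma filtration_sub s u v : filtration s u -> filtration s v -> filtration s (u - v).
Proof.
by move=> Fu Fv; rewrite -scaleN1r; apply/filtration_add/filtration_scale.
Qed.

Lemma filtration_le s t u : (s <= t)%N -> filtration t u -> filtration s u.
Proof. by move=> st [Nu u0]; split=> // j /leq_trans/(_ st)/u0. Qed.

Lemma filtrationS s u : filtration s u -> co s u = 0 -> filtration s.+1 u.
Proof.
move=> [Nu u0] us; split=> // j.
by rewrite ltnS leq_eqVlt => /predU1P[->|/u0].
Qed.

Lemma filtration0 s : filtration s 0.
Proof. by split=> [|j _]; [exact: mem0v | rewrite linear0]. Qed.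

Lemma filtration_f k : filtration k (f k).
Proof.
split=> [|j lt_jk]; first exact: basis_vector_mem.
have [k_in|/f_out->] := boolP (0 < k <= m)%N; last by rewrite linear0.
by rewrite co_f// gtn_eqF.
Qed.

Lemma filtration_top s u : (m < s)%N -> filtration s u -> u = 0.
Proof.
move=> lt_ms [Nu u0]; apply: coords_inj => // [|j]; first exact: mem0v.
rewrite linear0; have [j_in|/co_out//] := boolP (0 < j <= m)%N.
by apply: u0; lia.
Qed.

(** In the coefficient of weight at most s + t only the two leading terms can meet; all other pairs
    have larger total weight or a vanishing coordinate. *)
Lemma filtration_br s t u v : filtration s u -> filtration t v ->
  filtration (s + t) (br u v) /\ co (s + t)%N (br u v) = c s t * (co s u * co t v).
Proof.
move=> [Nu u0] [Nv v0]; split; first split.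
- exact: br_meml.
- move=> j lt_j; rewrite co_br//; apply: big1 => i _.
  have [/u0->|le_si] := ltnP i s; first by rewrite mul0r.
  have [le_ji|lt_ij] := leqP j i; first by rewrite coef_truncated0 ?mul0r ?mulr0.
  by rewrite v0 ?mulr0//; lia.
rewrite co_br// (@big_nat_only _ s) => [|i i_in ne_is|/co_out->].
- by rewrite addKn mulrCA.
- have [/u0->|le_si] := ltnP i s; first by rewrite mul0r.
  have [le_ji|lt_ij] := leqP (s + t)%N i.
    by rewrite coef_truncated0 ?mul0r ?mulr0.
  by rewrite v0 ?mulr0//; lia.
by rewrite mul0r.
Qed.

(** * Right multiplications that are triangular for the filtration *)

Section RightMultiplication.
Variables (y : V) (a : K).
Hypothesis y_triangular : forall k j, (0 < k <= m)%N -> (j <= k)%N ->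
  co j (br (f k) y) = (j == k)%:R * (k%:R * a).

Lemma filtration_right s u : filtration s u ->
  filtration s (br u y) /\ co s (br u y) = s%:R * a * co s u.
Proof.
move=> [Nu u0].
have coE j : co j (br u y) = \sum_(1 <= k < m.+1) co k u * co j (br (f k) y).
  rewrite {1}(co_sum Nu) (br_suml brL) raddf_sum /=.
  by apply: eq_bigr => k _; rewrite (brZl brL) linearZ.
split; first split=> [|j lt_js]; first exact: br_meml.
  rewrite coE; apply: big1_seq => k /=; rewrite mem_index_iota ltnS => k_in.
  have [/u0->|le_sk] := ltnP k s; first by rewrite mul0r.
  by rewrite y_triangular ?ltn_eqF ?mul0r ?mulr0//; lia.
rewrite coE (@big_nat_only _ s) => [|k k_in ne_ks|/co_out->]; last by rewrite mul0r.
  have [s_in|/co_out->] := boolP (0 < s <= m)%N; last by rewrite mulr0 mul0r.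
  by rewrite y_triangular// eqxx mul1r mulrC.
have [/u0->|le_sk] := ltnP k s; first by rewrite mul0r.
by rewrite y_triangular ?[s == k]eq_sym ?(negPf ne_ks) ?mul0r ?mulr0.
Qed.

End RightMultiplication.

(** * An eigenbasis for right multiplication by x *)

Section Eigenvectors.
Variable x : V.
Hypothesis x_triangular : forall k j, (0 < k <= m)%N -> (j <= k)%N ->
  co j (br (f k) x) = (j == k)%:R * (k%:R * 1).

Let filtration_x s u (Fu : filtration s u) := filtration_right x_triangular Fu.

(** Above weight k the operator v |-> [v, x] - k v is triangular with nonzero diagonal entries s -
    k, hence invertible. The solution is built weight by weight; [d] bounds the number of weights
    left before the filtration vanishes. *)
Lemma eigen_solve d : forall s k u, (m < s + d)%N -> (k < s)%N -> filtration s u ->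
  exists2 v, filtration s v & br v x - k%:R *: v = u.
Proof.
elim: d => [|d IHd] s k u.
  rewrite addn0 => lt_ms _ /(filtration_top lt_ms)->.
  by exists 0; [exact: filtration0 | rewrite (br0l brL) scaler0 subrr].
(* The operator multiplies the leading coefficient by s - k, so this [w] removes the term of weight
   s from [u]. *)
move=> lt_m lt_ks Fu; pose w := (co s u / (s%:R - k%:R)) *: f s.
have Fw : filtration s w := filtration_scale _ (filtration_f s).
have Fdw : filtration s (br w x - k%:R *: w).
  exact: filtration_sub (filtration_x Fw).1 (filtration_scale _ Fw).
have [|||v Fv vE] := IHd s.+1 k (u - (br w x - k%:R *: w)).
- by rewrite addSnnS.
- exact: ltnW.
- apply: filtrationS (filtration_sub Fu Fdw) _.
  rewrite linearB /= linearB /= (filtration_x Fw).2 mulr1.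
  rewrite [co s (_ *: w)]linearZ /= -mulrBl.
  have [s_in|s_out] := boolP (0 < s <= m)%N; last first.
    by rewrite !co_out// !mulr0 !subrr.
  rewrite /w linearZ /= co_f// eqxx mulr1 mulrC divfK ?subrr//.
  by rewrite subr_eq0 eqr_nat gtn_eqF.
exists (w + v); first exact: filtration_add Fw (filtration_le (leqnSn s) Fv).
by rewrite (brDl brL) scalerDr opprD addrACA vE addrC subrK.
Qed.

(** The leading coefficient of [u] is multiplied both by s and by k with s > k, so it is 0;
    repeating this pushes [u] out of the filtration. *)
Lemma eigen_unique d : forall s k u, (m < s + d)%N -> (k < s)%N -> filtration s u ->
  br u x = k%:R *: u -> u = 0.
Proof.
elim: d => [|d IHd] s k u; first by rewrite addn0 => lt_ms _ /(filtration_top lt_ms).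
move=> lt_m lt_ks Fu uE; apply: (IHd s.+1 k u) => //; first by rewrite addSnnS.
  exact: ltnW.
apply: filtrationS => //; apply/eqP.
have := (filtration_x Fu).2; rewrite uE linearZ /= mulr1 => /eqP.
by rewrite eq_sym -subr_eq0 -mulrBl mulf_eq0 subr_eq0 eqr_nat gtn_eqF.
Qed.

Lemma eigenvector_exists k : exists v, if (0 < k <= m)%N then
  [/\ filtration k v, co k v = 1 & br v x = k%:R *: v] else v = 0.
Proof.
have [k_in|_] := boolP (0 < k <= m)%N; last by exists 0.
have Fk := filtration_f k; have [Fdk cok] := filtration_x Fk.
have [|||v Fv vE] := @eigen_solve m k.+1 k (br (f k) x - k%:R *: f k).
- by rewrite addSn ltnS leq_addl.
- by [].
- apply: filtrationS; first exact: filtration_sub Fdk (filtration_scale _ Fk).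
  by rewrite linearB linearZ /= cok mulr1 subrr.
(* The error [f_k, x] - k f_k has weight above k, so a correction [v] of higher weight absorbs it
   and the leading coefficient stays 1. *)
exists (f k - v); split.
- exact: filtration_sub Fk (filtration_le (leqnSn k) Fv).
- by rewrite linearB /= Fv.2// co_f// eqxx subr0.
rewrite (brBl brL) scalerBr -[br (f k) x](subrK (k%:R *: f k)) -vE.
by rewrite addrAC [br v x - _ - _]addrAC subrr add0r addrC.
Qed.

Lemma eigenbasis_exists : exists f' : nat -> V,
  [/\ basis_of N [seq f' k | k <- iota 1 m],
      forall k, ~~ (0 < k <= m)%N -> f' k = 0,
      forall p q, br (f' p) (f' q) = c p q *: f' (p + q)%N &
      forall k, br (f' k) x = k%:R *: f' k].
Proof.
have [f' f'P] := choice eigenvector_exists.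
have f'_out k : ~~ (0 < k <= m)%N -> f' k = 0.
  by move=> /negPf k_out; have := f'P k; rewrite k_out.
have f'_in k : (0 < k <= m)%N ->
    [/\ filtration k (f' k), co k (f' k) = 1 & br (f' k) x = k%:R *: f' k].
  by move=> k_in; have := f'P k; rewrite k_in.
have f'_eig k : br (f' k) x = k%:R *: f' k.
  have [/f'_in[]//|/f'_out->] := boolP (0 < k <= m)%N.
  by rewrite (br0l brL) scaler0.
have f'_fil k : filtration k (f' k).
  have [/f'_in[]//|/f'_out->] := boolP (0 < k <= m)%N.
  exact: filtration0.
exists f'; split=> // [|p q].
- rewrite basisEdim size_map size_iota (size_basis f_basis) leqnn andbT.
  (* The new vectors are unitriangular in the old ones: leading terms are subtracted one after
     another. *)
  have spanF d : forall s u, (m < s + d)%N -> filtration s u ->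
      u \in <<[seq f' k | k <- iota 1 m]>>%VS.
    elim: d => [|d IHd] s u lt_m Fu.
      by rewrite (filtration_top _ Fu) ?mem0v// -[s]addn0.
    have Fsub : filtration s.+1 (u - co s u *: f' s).
      apply: filtrationS.
        exact: filtration_sub Fu (filtration_scale _ (f'_fil s)).
      rewrite linearB linearZ /=.
      have [/f'_in[_ -> _]|/co_out->] := boolP (0 < s <= m)%N.
        by rewrite mulr1 subrr.
      by rewrite mul0r subrr.
    rewrite -(subrK (co s u *: f' s) u) rpredD//.
      by apply: IHd Fsub; rewrite addSnnS.
    apply: rpredZ; have [s_in|/f'_out->] := boolP (0 < s <= m)%N; last exact: mem0v.
    by apply: memv_span; rewrite map_f// mem_iota; lia.
  by apply/subvP => u Nu; apply: (spanF m.+1 0%N) => //; split.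
have [Fbr cobr] := filtration_br (f'_fil p) (f'_fil q).
(* As a derivation, right multiplication by x adds eigenvalues. The bracket and
   [c p q *: f' (p + q)] are thus both in the eigenspace of p + q with equal leading terms, and
   [eigen_unique] kills their difference. *)
have br_eig : br (br (f' p) (f' q)) x = (p + q)%:R *: br (f' p) (f' q).
  rewrite (br_derivation brL) !f'_eig (brZl brL) (brZr brL) -scalerDl -natrD.
  by rewrite addnC.
apply/eqP; rewrite -subr_eq0; apply/eqP.
apply: (@eigen_unique m (p + q).+1 (p + q)%N) => //.
- by rewrite addSn ltnS leq_addl.
- apply: filtrationS; first exact: filtration_sub Fbr (filtration_scale _ (f'_fil _)).
  rewrite linearB linearZ /= cobr.
  have [->|/c_supp c_pq] := eqVneq (c p q) 0; first by rewrite !mul0r subrr.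
  have [_ -> _] := f'_in p ltac:(lia); have [_ -> _] := f'_in q ltac:(lia).
  by have [_ -> _] := f'_in (p + q)%N ltac:(lia); rewrite !mulr1 subrr.
by rewrite (brBl brL) (brZl brL) f'_eig br_eig scalerBr !scalerA mulrC.
Qed.

End Eigenvectors.

(** * The extension of N by one element x *)

Section CodimensionOne.
Variable x : V.
Hypothesis span_x : forall v, exists n b, n \in N /\ v = n + b *: x.

Lemma square_mem : br x x \in N.
Proof. exact: square_in_codim1_ideal. Qed.

Lemma br_mem u v : br u v \in N.
Proof.
have [[n [b [Nn ->]]] [n' [b' [Nn' ->]]]] := (span_x u, span_x v).
rewrite (brDr brL) (brZr brL); apply: rpredD; first exact: br_memr.
apply: rpredZ; rewrite (brDl brL) (brZl brL); apply: rpredD; first exact: br_meml.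
exact/rpredZ/square_mem.
Qed.

Lemma strict_right_nilpotent :
  (forall k j, (0 < k <= m)%N -> (j <= k)%N ->
     co j (br (f k) x) = (j == k)%:R * (k%:R * 0)) ->
  nilpotent_sub br fullv.
Proof.
move=> x_strict.
have step s u v : filtration s u -> filtration s.+1 (br u v).
  move=> Fu; have [n [b [Nn ->]]] := span_x v.
  rewrite (brDr brL) (brZr brL); apply: filtration_add.
    have F1 : filtration 1 n by split=> // -[|//] _; exact: co_out.
    by have [] := filtration_br Fu F1; rewrite addn1.
  have [Fux coux] := filtration_right x_strict Fu.
  by apply/filtration_scale/filtrationS; rewrite ?coux ?mulr0 ?mul0r.
(* The shift by one comes from the first bracket, which only lands in [N], that is in filtration
   step 0; each later one gains a weight. *)
have lcsF k : forall u, u \in lcs br fullv k.+1 -> filtration k u.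
  elim: k => [|k IHk] u /=.
    apply: (brs_ind (P := filtration 0)); first exact: filtration0.
    - by move=> u1 u2; exact: filtration_add.
    - by move=> a u1; exact: filtration_scale.
    by move=> u1 u2 _ _; split=> //; exact: br_mem.
  apply: (brs_ind (P := filtration k.+1)); first exact: filtration0.
  - by move=> u1 u2; exact: filtration_add.
  - by move=> a u1; exact: filtration_scale.
  by move=> u1 u2 /IHk Fu1 _; exact: step.
exists m.+2; apply/eqP; rewrite -subv0; apply/subvP => u /lcsF Fu.
by rewrite (filtration_top _ Fu) ?mem0v.
Qed.

Hypothesis x_eigen : forall k, br (f k) x = k%:R *: f k.
Hypothesis c_central : forall k, (0 < k <= m)%N ->
  (exists i, c i k != 0) \/ (exists p q, (p + q)%N = k /\ c p q != 0).

Lemma right_annihilator_coord z i k : z \in N -> (forall u, br u z = 0) ->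
  c i k != 0 -> co k z = 0.
Proof.
move=> Nz ann c_ik; have := co_fbr (i + k) i Nz.
rewrite ann linear0 addKn => /esym/eqP.
by rewrite mulf_eq0 (negPf c_ik) => /eqP.
Qed.

(** The failure of antisymmetry at f_k. It lies in [N] and every element annihilates it from the
    left. *)
Let defect k := br x (f k) + br (f k) x.

Lemma defect_mem k : defect k \in N.
Proof.
by apply: rpredD; [apply: br_memr | apply: br_meml]; exact: basis_vector_mem.
Qed.

Lemma left_defect k : br x (f k) = defect k - k%:R *: f k.
Proof. by rewrite /defect x_eigen addrK. Qed.

(** Inside [N] the bracket is antisymmetric, so the vanishing of [f_q, defect] carries over to the
    other side. *)
Lemma defect_central k q : br (defect k) (f q) = 0.
Proof.
rewrite (br_anti (basis_vector_mem q) (defect_mem k)) /defect.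
by rewrite (br_symmetrized_r brL) oppr0.
Qed.

(** In [x, [f_p, f_q]] = [[x, f_p], f_q] - [[x, f_q], f_p] the defects drop out, leaving the weights
    - p and - q, which add up. *)
Lemma left_weight_product p q : c p q != 0 ->
  br x (f (p + q)%N) = - ((p + q)%:R *: f (p + q)%N).
Proof.
move=> c_pq; apply: (scalerI c_pq); rewrite -(brZr brL) -brf brL.2.
rewrite !left_defect !(brBl brL) !defect_central !(brZl brL) !brf.
rewrite (c_anti p q) [(q + p)%N]addnC !scalerA !sub0r mulrN scaleNr opprK.
by rewrite -opprD -scalerDl -mulrDl -natrD mulrC scalerN scalerA.
Qed.

Lemma right_annihilator0 z : z \in N -> (forall u, br u z = 0) -> z = 0.
Proof.
move=> Nz ann; apply: coords_inj => // [|j]; first exact: mem0v.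
rewrite linear0; have [j_in|/co_out//] := boolP (0 < j <= m)%N.
(* The coefficient of f_j in [x, z] = 0 is examined. Components of [z] along noncentral vectors
   already vanish; on products x acts by minus the weight, so only k = j contributes, with the
   nonzero factor j. *)
have /eqP : - co j (br x z) = 0 by rewrite ann linear0 oppr0.
rewrite {1}(co_sum Nz) (br_sumr brL) raddf_sum -sumrN (@big_nat_only _ j) /=.
- have [[i c_ij]|[p [q [<- c_pq]]]] := c_central j_in.
    by move=> _; exact: (right_annihilator_coord Nz ann c_ij).
  have pq_in : (0 < p + q <= m)%N by have := c_supp c_pq; lia.
  rewrite (brZr brL) linearZ /= left_weight_product// linearN linearZ /= co_f//.
  rewrite eqxx mulr1 mulrN opprK mulf_eq0 pnatr_eq0.
  by case/orP => [/eqP//|]; lia.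
- move=> k k_in ne_kj; rewrite (brZr brL) linearZ /=.
  have [[i c_ik]|[p [q [def_k c_pq]]]] := c_central k_in.
    by rewrite (right_annihilator_coord Nz ann c_ik) mul0r oppr0.
  rewrite -def_k left_weight_product// def_k linearN linearZ /= co_f//.
  by rewrite (negPf ne_kj) mulr0 oppr0 mulr0 oppr0.
- by rewrite j_in.
Qed.

Lemma left_weight k : br x (f k) = - (k%:R *: f k).
Proof.
rewrite left_defect (_ : defect k = 0) ?sub0r//; apply: right_annihilator0.
  exact: defect_mem.
by move=> u; exact: br_symmetrized_r.
Qed.

Lemma square_eq0 : br x x = 0.
Proof.
apply: right_annihilator0; first exact: square_mem.
by move=> u; exact: br_square_r.
Qed.

End CodimensionOne.

(* For the degree -t component D of a derivation, [eta k] is the coefficient of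
   f_(k - t) in D f_k. Truncation of p - t is harmless: [eta p] is 0 there. *)
Definition derivations_diagonal : Prop :=
  forall t (eta : nat -> K), (forall k, (k <= t)%N -> eta k = 0) ->
  (forall p q, c p q * eta (p + q)%N =
     eta p * c (p - t)%N q + eta q * c p (q - t)%N) ->
  forall k, (0 < k <= m)%N -> eta k = (t == 0)%N%:R * (k%:R * eta 1%N).

(** Right multiplication by [y] is a derivation, so each homogeneous component of degree - t is one
    too, and the rigidity hypothesis applies to it with t = k - j. *)
Lemma right_triangular y : derivations_diagonal ->
  exists a, forall k j, (0 < k <= m)%N -> (j <= k)%N ->
    co j (br (f k) y) = (j == k)%:R * (k%:R * a).
Proof.
move=> diag; exists (co 1%N (br (f 1%N) y)) => k [|j] k_in le_jk.
  by rewrite co_out// [(0 == k)%N]ltn_eqF ?mul0r//; case/andP: k_in.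
pose t := (k - j.+1)%N.
(* The component of degree - t of u |-> [u, y], set to 0 where its target would have index below
   1. *)
pose eta i := if (t < i)%N then co (i - t)%N (br (f i) y) else 0.
have eta_le i : (i <= t)%N -> eta i = 0 by rewrite /eta ltnNge => ->.
have c0l q : c 0%N q = 0.
  by apply/eqP/negPn/negP => /c_supp.
have c0r p : c p 0%N = 0 by rewrite c_anti c0l oppr0.
have eta_der p q : c p q * eta (p + q)%N =
    eta p * c (p - t)%N q + eta q * c p (q - t)%N.
  have etaEl : eta p * c (p - t)%N q = co (p - t)%N (br (f p) y) * c (p - t)%N q.
    rewrite /eta; case: ltnP => // le_pt.
    by rewrite (eqP (le_pt : p - t == 0)%N) c0l !mulr0.
  have etaEr : eta q * c p (q - t)%N = co (q - t)%N (br (f q) y) * c p (q - t)%N.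
    rewrite /eta; case: ltnP => // le_qt.
    by rewrite (eqP (le_qt : q - t == 0)%N) c0r !mulr0.
  have [le_pqt|lt_tpq] := leqP (p + q) t.
    by rewrite !eta_le ?mulr0 ?mul0r ?addr0//; lia.
  (* The derivation rule for [[f_p, f_q], y] is compared at the coefficient of weight p + q - t. *)
  have := congr1 (co (p + q - t)%N) (br_derivation brL (f p) (f q) y).
  rewrite brf (brZl brL) linearZ linearD /=.
  rewrite [co _ (br (f p) _)]co_fbr ?co_brf ?br_meml ?basis_vector_mem//.
  rewrite etaEl etaEr {1}/eta lt_tpq => ->; rewrite addrC [c p _ * _]mulrC.
  by congr (co _ _ * c _ _ + co _ _ * c _ _); lia.
have := diag t eta eta_le eta_der k k_in.
have -> : eta k = co j.+1 (br (f k) y).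
  by rewrite /eta ifT; [congr (co _ _) | ]; rewrite /t; lia.
rewrite [(t == 0)%N](_ : _ = (j.+1 == k)); last by rewrite /t; lia.
move=> ->; case: eqP => [def_k|_]; last by rewrite !mul0r.
have t0 : t = 0%N by rewrite /t; lia.
by rewrite /eta t0 subn0.
Qed.

End GradedBasis.

(** * Criteria forcing derivations of nonpositive degree to be diagonal *)

Section DiagonalDerivations.
Variables (K : numFieldType) (m : nat) (c : nat -> nat -> K).
Hypothesis m_ge7 : (7 <= m)%N.
Hypothesis c_anti : forall p q, c q p = - c p q.

Lemma coef_diag p : c p p = 0.
Proof. by have /eqP := c_anti p p; rewrite -addr_eq0 -mulr2n mulrn_eq0 => /eqP. Qed.

(** f_1 and f_2 generate everything: f_3, ..., f_(m-1) by repeated brackets with f_1, and f_m as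
    [f_2, f_(m-2)]. The relation between [eta 1] and [eta 2] comes from the two expressions
    [f_2, f_3] and [f_1, f_4] of f_5. *)
Lemma two_generators_diagonal :
  (forall k, (2 <= k <= m - 2)%N -> c 1 k = 1) -> c 2 3 = 1 -> c 2 (m - 2) = 1 ->
  derivations_diagonal m c.
Proof.
move=> c1 c23 c2m t eta eta0 der.
have der1 k : (2 <= k <= m - 2)%N ->
    eta k.+1 = eta 1%N * c (1 - t) k + eta k * c 1 (k - t).
  by move=> k_in; have := der 1%N k; rewrite c1// mul1r.
have := der 2%N 3%N; have := der 2%N (m - 2)%N.
rewrite c23 c2m !mul1r subnKC ?(leq_trans _ m_ge7)//.
have [t0|t_gt0] := posnP t.
  subst t; rewrite !subn0; rewrite c23 c2m !mulr1 => eta_m eta_5.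
  have succ k : (2 <= k <= m - 2)%N -> eta k.+1 = eta 1%N + eta k.
    by move=> k_in; rewrite der1// !subn0 c1// !mulr1.
  have eta_2 : eta 2 = 2%:R * eta 1%N.
    have := eta_5; rewrite (succ 4%N) ?(succ 3%N); [|lia..].
    by rewrite addrA => /addIr <-; rewrite mulr2n mulrDl mul1r.
  have eta_k k : (0 < k <= m.-1)%N -> eta k = k%:R * eta 1%N.
    elim: k => // -[|[|k]] IHk k_in; rewrite ?mul1r//.
    rewrite succ ?IHk; [|lia..].
    by rewrite -[X in X + _]mul1r -mulrDl nat1r.
  move=> k k_in; rewrite mul1r.
  have [->|ne_km] := eqVneq k m; last by apply: eta_k; lia.
  rewrite eta_m (eta_k 2%N) ?(eta_k (m - 2)%N); [|lia..].
  by rewrite -mulrDl -natrD subnKC//; lia.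
move=> eta_m eta_5.
have eta_1 : eta 1%N = 0 by exact: eta0.
have zero_from k : (2 <= k <= m - 2)%N -> eta k = 0 -> eta k.+1 = 0.
  by move=> k_in eta_k; rewrite der1// eta_k eta_1 !mul0r addr0.
(* Truncation settles t >= 2. For t = 1, [f_1, f_1] = 0 gives [eta 3 = 0], hence [eta 5 = 0], and
   f_5 = [f_2, f_3] then gives [eta 2 = 0]. *)
have eta_2 : eta 2 = 0.
  have [/eta0//|] := leqP 2%N t; rewrite ltnS => t_le1.
  have t1 : t = 1%N by lia.
  move: eta_5; rewrite t1.
  have eta_3 : eta 3 = 0.
    by rewrite der1 ?t1 ?coef_diag ?mulr0 ?eta_1 ?mul0r ?addr0//; lia.
  rewrite eta_3 c1 ?(zero_from 4%N) ?(zero_from 3%N) ?mulr1 ?mul0r ?addr0//; lia.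
have eta_k k : (0 < k <= m.-1)%N -> eta k = 0.
  elim: k => // -[|[|k]] IHk k_in //.
  by apply: zero_from; [|apply: IHk]; lia.
move=> k k_in; rewrite mul0r.
have [->|ne_km] := eqVneq k m; last by apply: eta_k; lia.
by rewrite eta_m eta_2 eta_k ?mul0r ?addr0//; lia.
Qed.

(** As [f_1, f_2] = 0, f_3 is a further generator. In degree 0, f_5 = [f_3, f_2] = [f_1, f_4]
    determines [eta 2], and f_7 = [f_3, f_4] = [f_1, f_6] determines [eta 3]. *)
Lemma three_generators_diagonal :
  (forall k, (3 <= k <= m.-1)%N -> c 1 k = 1) -> c 1 2 = 0 ->
  c 3 2 = 1 -> c 4 2 = 1 -> c 3 4 = 1 ->
  derivations_diagonal m c.
Proof.
move=> c1 c12 c32 c42 c34 t eta eta0 der.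
have der1 k : (3 <= k <= m.-1)%N ->
    eta k.+1 = eta 1%N * c (1 - t) k + eta k * c 1 (k - t).
  by move=> k_in; have := der 1%N k; rewrite c1// mul1r.
have := der 3%N 2%N; have := der 3%N 4%N; rewrite c32 c34 !mul1r.
have [t0|t_gt0] := posnP t.
  subst t; rewrite !subn0; rewrite c32 c34 !mulr1 => eta_7 eta_5.
  have succ k : (3 <= k <= m.-1)%N -> eta k.+1 = eta 1%N + eta k.
    by move=> k_in; rewrite der1// !subn0 c1// !mulr1.
  have eta_4 := succ 3%N ltac:(lia).
  have eta_2 : eta 2 = 2%:R * eta 1%N.
    have := eta_5; rewrite (succ 4%N) ?eta_4; last by lia.
    by rewrite addrA [RHS]addrC => /addIr <-; rewrite mulr2n mulrDl mul1r.
  have eta_3 : eta 3 = 3%:R * eta 1%N.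
    have := eta_7; rewrite eta_4 (succ 6%N) ?(succ 5%N) ?(succ 4%N) ?eta_4; [|lia..].
    rewrite addrA [RHS]addrA !addrA => /addIr/addIr <-.
    by ring.
  have eta_k k : (0 < k <= m)%N -> eta k = k%:R * eta 1%N.
    elim: k => // -[|[|[|k]]] IHk k_in; rewrite ?mul1r//.
    rewrite succ ?IHk; [|lia..].
    by rewrite -[X in X + _]mul1r -mulrDl nat1r.
  by move=> k k_in; rewrite mul1r eta_k.
move=> eta_7 eta_5.
have eta_1 : eta 1%N = 0 by exact: eta0.
have zero_from k : (3 <= k <= m.-1)%N -> eta k = 0 -> eta k.+1 = 0.
  by move=> k_in eta_k; rewrite der1// eta_k eta_1 !mul0r addr0.
have small : eta 4 = 0 -> eta 5 = 0 /\ eta 7 = 0.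
  move=> eta_4; have eta5 : eta 5 = 0 by apply: zero_from => //; lia.
  by split=> //; apply: (zero_from 6%N); [lia|apply: zero_from => //; lia].
(* For t = 1 and t = 2, f_4 = [f_1, f_3] gives [eta 4 = 0], since its image involves [f_1, f_2] or
   [f_1, f_1]. So [eta 5] and [eta 7] vanish, and the relations for f_5 and f_7 yield the rest. *)
have [eta_2 eta_3] : eta 2 = 0 /\ eta 3 = 0.
  have [t1|t_ne1] := eqVneq t 1%N.
    have eta_4 : eta 4 = 0 by rewrite der1 ?t1 ?c12 ?mulr0 ?eta_1 ?mul0r ?addr0//; lia.
    have [eta5 eta7] := small eta_4.
    move: eta_5 eta_7; rewrite t1 eta5 eta7 eta_4 coef_diag mulr0 add0r mul0r addr0.
    rewrite (c_anti 1%N 3%N) (c_anti 4%N 2%N) c42 c1; last by lia.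
    rewrite !mulrN !mulr1 => /esym/eqP; rewrite oppr_eq0 => /eqP-> /esym/eqP.
    by rewrite oppr_eq0 => /eqP->.
  have eta_2 : eta 2 = 0 by apply: eta0; lia.
  split=> //; have [/eta0//|t_lt3] := leqP 3%N t.
  have t2 : t = 2%N by lia.
  have eta_4 : eta 4 = 0.
    by rewrite der1 ?t2 ?coef_diag ?mulr0 ?eta_1 ?mul0r ?addr0//; lia.
  have [eta5 eta7] := small eta_4.
  move: eta_7; rewrite t2 eta7 eta_4 mul0r addr0 c1 ?mulr1//; lia.
have eta_k k : (0 < k <= m)%N -> eta k = 0.
  elim: k => // -[|[|[|k]]] IHk k_in //.
  by apply: zero_from; [|apply: IHk]; lia.
by move=> k k_in; rewrite mul0r eta_k.
Qed.

(** The dichotomy behind the vanishing of right annihilators: the first kind of component is tested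
    by brackets in N, the second by brackets with x. *)
Definition noncentral_or_product : Prop :=
  forall k, (0 < k <= m)%N ->
    (exists i, c i k != 0) \/ (exists p q, (p + q)%N = k /\ c p q != 0).

Lemma two_generators_central :
  (forall k, (2 <= k <= m - 2)%N -> c 1 k = 1) -> c 2 (m - 2) = 1 ->
  noncentral_or_product.
Proof.
move=> c1 c2m [|[|[|k]]] // k_in.
- by left; exists 2%N; rewrite c_anti c1 ?oppr_eq0 ?oner_eq0//; lia.
- by left; exists 1%N; rewrite c1 ?oner_eq0//; lia.
right; have [k_m|k_ne] := eqVneq k.+3 m.
  by exists 2%N, (m - 2)%N; rewrite c2m oner_eq0; split=> //; lia.
by exists 1%N, k.+2; rewrite c1 ?oner_eq0//; lia.
Qed.

Lemma three_generators_central :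
  (forall k, (3 <= k <= m.-1)%N -> c 1 k = 1) -> c 3 2 = 1 -> noncentral_or_product.
Proof.
move=> c1 c32 [|[|[|[|k]]]] // k_in.
- by left; exists 3%N; rewrite c_anti c1 ?oppr_eq0 ?oner_eq0//; lia.
- by left; exists 3%N; rewrite c32 oner_eq0.
- by left; exists 1%N; rewrite c1 ?oner_eq0//; lia.
by right; exists 1%N, k.+3; rewrite c1 ?oner_eq0//; lia.
Qed.

End DiagonalDerivations.

(** * Codimension one extensions of a rigid graded nilradical *)

Lemma graded_extension (K : numFieldType) (V : vectType K) (br : V -> V -> V)
    (N : {vspace V}) (m : nat) (c : nat -> nat -> K) (f : nat -> V) :
  leibniz_algebra br -> nilradical br N ->
  \dim (fullv : {vspace V}) = (\dim N).+1 ->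
  (forall p q, c p q != 0 -> [&& 0 < p, 0 < q & p + q <= m]%N) ->
  (forall p q, c q p = - c p q) ->
  noncentral_or_product m c ->
  derivations_diagonal m c ->
  basis_of N [seq f k | k <- iota 1 m] ->
  (forall k, ~~ (0 < k <= m)%N -> f k = 0) ->
  (forall p q, br (f p) (f q) = c p q *: f (p + q)%N) ->
  exists (f' : nat -> V) (x : V),
    [/\ basis_of N [seq f' k | k <- iota 1 m] /\ x \notin N,
        forall k, ~~ (0 < k <= m)%N -> f' k = 0,
        forall p q, br (f' p) (f' q) = c p q *: f' (p + q)%N,
        forall k, br (f' k) x = k%:R *: f' k /\ br x (f' k) = - (k%:R *: f' k) &
        br x x = 0].
Proof.
move=> brL [idN _ maxN] dimV c_supp c_anti c_central diag fB f_out brf.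
have [co [co_sum co_f co_out]] := basis_coordinates fB.
have /subvPn[y _ Ny] : ~~ (fullv <= N)%VS.
  by apply/negP => /dimvS; rewrite dimV ltnn.
have span_y v : exists n b, n \in N /\ v = n + b *: y.
  have : v \in (N + <[y]>)%VS.
    suff -> : (N + <[y]>)%VS = fullv by exact: memvf.
    apply/eqP; rewrite eqEdim subvf /= dimV.
    rewrite (ltn_leqif (dimv_leqif_sup (addvSl N <[y]>%VS))).
    by apply: contraNN Ny => /(subv_trans (addvSr N <[y]>%VS)); rewrite memvE.
  by case/memv_addP => n Nn [_ /vlineP[b ->] ->]; exists n, b.
have [a y_tri] :=
  right_triangular brL idN c_supp c_anti fB f_out brf co_sum co_f co_out y diag.
have [a0|a_neq0] := eqVneq a 0.
  rewrite a0 in y_tri.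
  have nilV :=
    strict_right_nilpotent brL idN c_supp fB brf co_sum co_f co_out span_y y_tri.
  have fullN := maxN fullv (fun u v _ => conj (memvf _) (memvf _)) nilV (subvf N).
  by move/eqP: dimV; rewrite -fullN ltn_eqF.
(* This scaling turns the diagonal entries k a into the weights k. *)
pose x := a^-1 *: y.
have Nx : x \notin N by rewrite rpredZeq negb_or invr_eq0 a_neq0.
have span_x v : exists n b, n \in N /\ v = n + b *: x.
  have [n [b [Nn ->]]] := span_y v; exists n, (b * a); split=> //.
  by rewrite scalerA mulfK.
have x_tri k j : (0 < k <= m)%N -> (j <= k)%N ->
    co j (br (f k) x) = (j == k)%:R * (k%:R * 1).
  move=> k_in le_jk; rewrite (brZr brL) linearZ /= y_tri// mulr1.
  by rewrite mulrCA (mulrCA a^-1) mulVf ?mulr1.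
have [f' [f'B f'_out brf' f'x]] :=
  eigenbasis_exists brL idN c_supp fB f_out brf co_sum co_f co_out x_tri.
(* The eigenbasis has the same structure constants, so the results on graded bases apply again with
   its own coordinates. *)
have [co' [co'_sum co'_f co'_out]] := basis_coordinates f'B.
exists f', x; split=> // [k|].
  split=> //.
  exact: (left_weight brL idN c_supp c_anti f'B f'_out brf'
    co'_sum co'_f co'_out f'x c_central).
exact: (square_eq0 brL idN c_supp c_anti f'B f'_out brf'
    co'_sum co'_f co'_out span_x f'x c_central).
Qed.

(** * Multiplication tables compatible with a weight *)

Section Tables.
Variable K : numFieldType.

Definition table_coef (L : seq (entry K)) (i j : nat) : K :=
  \sum_(t <- L) (if (ei t == i) && (ej t == j) then ea t
                 else if (ei t == j) && (ej t == i) then - ea t else 0).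

(** The condition [ei t != ej t] prevents an entry from matching a pair in both orders, which
    antisymmetry relies on. *)
Definition graded_entry (m : nat) (w : nat -> nat) (t : entry K) : bool :=
  [&& (0 < ei t <= m)%N, (0 < ej t <= m)%N, (0 < ek t <= m)%N, ei t != ej t &
      w (ek t) == (w (ei t) + w (ej t))%N].

Lemma table_coef_cat L L' i j :
  table_coef (L ++ L') i j = table_coef L i j + table_coef L' i j.
Proof. exact: big_cat. Qed.

Variables (m : nat) (w : nat -> nat).

Lemma table_coef_anti L i j :
  all (graded_entry m w) L -> table_coef L j i = - table_coef L i j.
Proof.
rewrite /table_coef; elim: L => [|t L IHL] /=; first by rewrite !big_nil oppr0.
move=> /andP[/and5P[_ _ _ ne_t _] /IHL]; rewrite !big_cons opprD => ->.
have : ~~ ((ei t == j) && (ej t == i) && ((ei t == i) && (ej t == j))).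
  by apply: contraNN ne_t => /andP[/andP[_ /eqP->] /andP[/eqP-> _]].
move=> excl; congr (_ + _).
move: excl; case: ((ei t == j) && (ej t == i));
  case: ((ei t == i) && (ej t == j)) => //=.
all: by rewrite ?opprK ?oppr0.
Qed.

Lemma table_coef_supp L i j : all (graded_entry m w) L -> table_coef L i j != 0 ->
  exists2 k, (0 < k <= m)%N & w k = (w i + w j)%N.
Proof.
rewrite /table_coef; elim: L => [|t L IHL] /=; first by rewrite big_nil eqxx.
move=> /andP[/and5P[_ _ k_in _ /eqP wk] /IHL {}IHL]; rewrite big_cons.
case: ifP => [/andP[/eqP<- /eqP<-] _|_]; first by exists (ek t).
case: ifP => [/andP[/eqP<- /eqP<-] _|_]; first by exists (ek t); rewrite // addnC.
by rewrite add0r.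
Qed.

(** All entries matching the pair i, j have a target of weight [w i + w j], so their sum is a
    multiple of a single vector. *)
Lemma table_br_graded (V : vectType K) L (e f : nat -> V) i j :
  all (graded_entry m w) L -> (forall k, (0 < k <= m)%N -> e k = f (w k)) ->
  table_br L e i j = table_coef L i j *: f (w i + w j)%N.
Proof.
move=> gL ef; rewrite /table_br /table_coef scaler_suml.
elim: L gL => [|t L IHL] /=; first by rewrite !big_nil.
move=> /andP[/and5P[_ _ k_in _ /eqP wk] /IHL {}IHL]; rewrite !big_cons IHL.
congr (_ + _); rewrite ef// wk.
case: ifP => [/andP[/eqP<- /eqP<-] //|_].
case: ifP => [/andP[/eqP<- /eqP<-]|_]; last by rewrite scale0r.
by rewrite scaleNr addnC.
Qed.

End Tables.

(* In g^3_(n,1) the vectors of weight 1, 2, 3, ..., n are e_1, e_n, e_2, ...,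
   e_(n-1); in the other algebras e_i has weight i. *)
Definition weight (g : nilalg) (i : nat) : nat :=
  if g is G3n1 n then (if i == 1 then 1 else if i == n then 2 else i.+1)%N else i.

Definition unweight (g : nilalg) (p : nat) : nat :=
  if g is G3n1 n then (if p == 1 then 1 else if p == 2 then n else p.-1)%N else p.

(** Structure constants in the indexing by weight. The guard excludes out-of-range indices, where
    [unweight] can return a genuine but wrong index. *)
Definition graded_coef (K : numFieldType) (g : nilalg) (p q : nat) : K :=
  if [&& 0 < p, 0 < q & p + q <= nildim g]%N
  then table_coef (nil_table K g) (unweight g p) (unweight g q) else 0.

Lemma weight_range g i : nilalg_ok g -> (0 < i <= nildim g)%N ->
  (0 < weight g i <= nildim g)%N.
Proof. by case: g => //= n n_ge7 i_in; do 2?case: eqP => ?; lia. Qed.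

Lemma unweight_range g p : nilalg_ok g -> (0 < p <= nildim g)%N ->
  (0 < unweight g p <= nildim g)%N.
Proof. by case: g => //= n n_ge7 i_in; do 2?case: eqP => ?; lia. Qed.

Lemma weightK g i : nilalg_ok g -> (0 < i <= nildim g)%N ->
  unweight g (weight g i) = i.
Proof.
case: g => //= n n_ge7 i_in; case: (i =P 1%N) => [->//|i1].
by case: (i =P n) => [->|i_n] //=; rewrite !ifF //; apply/eqP; lia.
Qed.

Lemma unweightK g p : nilalg_ok g -> (0 < p <= nildim g)%N ->
  weight g (unweight g p) = p.
Proof.
case: g => //= n n_ge7 p_in; case: (p =P 1%N) => [->//|p1].
by case: (p =P 2%N) => [->|p2] //=; do 2?case: eqP => ?; lia.
Qed.

Lemma nil_table_graded (K : numFieldType) g :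
  nilalg_ok g -> all (graded_entry (nildim g) (weight g)) (nil_table K g).
Proof.
case: g => //= n n_ge7; rewrite !all_cat !all_map.
apply/and3P; split; apply/allP => i; rewrite mem_iota /= => i_in.
all: by apply/and5P; split=> /=; do ?case: ifP => [/eqP ?|/eqP ?]; lia.
Qed.

Lemma graded_coef_supp (K : numFieldType) g p q :
  graded_coef K g p q != 0 -> [&& 0 < p, 0 < q & p + q <= nildim g]%N.
Proof. by rewrite /graded_coef; case: ifP => //; rewrite eqxx. Qed.

Lemma graded_coef_anti (K : numFieldType) g p q : nilalg_ok g ->
  graded_coef K g q p = - graded_coef K g p q.
Proof.
move=> g_ok; rewrite /graded_coef addnC andbCA; case: ifP => _; last by rewrite oppr0.
exact: table_coef_anti (nil_table_graded K g_ok).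
Qed.

(** The guard of [graded_coef] loses nothing: a nonzero coefficient has a target in range, which
    bounds the sum of the weights. *)
Lemma table_coef_weight (K : numFieldType) g i j : nilalg_ok g ->
  (0 < i <= nildim g)%N -> (0 < j <= nildim g)%N ->
  table_coef (nil_table K g) i j = graded_coef K g (weight g i) (weight g j).
Proof.
move=> g_ok i_in j_in; rewrite /graded_coef !weightK//.
have /andP[-> _] := weight_range g_ok i_in; have /andP[-> _] := weight_range g_ok j_in.
case: ifP => //= /negP le_m; apply/eqP/negPn/negP.
move=> /(table_coef_supp (nil_table_graded K g_ok))[k k_in wk]; apply: le_m.
by rewrite -wk; case/andP: (weight_range g_ok k_in).
Qed.

Definition entry_on (K : fieldType) (i j : nat) (t : entry K) : bool :=
  ((ei t == i) && (ej t == j)) || ((ei t == j) && (ej t == i)).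

Lemma table_coef_map0 (K : numFieldType) (h : nat -> entry K) s i j :
  (forall k, k \in s -> ~~ entry_on i j (h k)) ->
  table_coef [seq h k | k <- s] i j = 0.
Proof.
move=> off; rewrite /table_coef big_map big_seq big1// => k /off.
by rewrite /entry_on negb_or => /andP[/negPf-> /negPf->].
Qed.

Lemma table_coef_map1 (K : numFieldType) (h : nat -> entry K) s k0 i j :
  uniq s -> k0 \in s -> ei (h k0) = i -> ej (h k0) = j ->
  (forall k, k \in s -> k != k0 -> ~~ entry_on i j (h k)) ->
  table_coef [seq h k | k <- s] i j = ea (h k0).
Proof.
move=> s_uniq k0s hi hj off; rewrite /table_coef big_map (bigD1_seq k0)//=.
rewrite hi hj !eqxx /= big_seq_cond big1 ?addr0// => k /andP[ks /(off k ks)].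
by rewrite /entry_on negb_or => /andP[/negPf-> /negPf->].
Qed.

(** * Structure constants of the four families *)

Section CoefficientsG3n1.
Variables (K : numFieldType) (n : nat).
Hypothesis n_ge7 : (7 <= n)%N.

Lemma g3n1_coef_1 k : (3 <= k <= n.-1)%N -> graded_coef K (G3n1 n) 1 k = 1.
Proof.
move=> k_in; rewrite /graded_coef ifT /=; last by lia.
rewrite ifF; last by lia.
rewrite ifF; last by lia.
(* Weight k >= 3 belongs to e_(k-1), so the entry hit is [e_1, e_(k-1)] = e_k in the first block. *)
rewrite !table_coef_cat (@table_coef_map1 _ _ _ k.-1) ?iota_uniq ?mem_iota//=; try lia.
  by rewrite !table_coef_map0 ?addr0// => i; rewrite mem_iota /entry_on /=; lia.
by move=> i; rewrite mem_iota /entry_on /=; lia.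
Qed.

Lemma g3n1_coef_12 : graded_coef K (G3n1 n) 1 2 = 0.
Proof.
rewrite /graded_coef ifT /=; last by lia.
rewrite !table_coef_cat !table_coef_map0 ?addr0// => i.
all: by rewrite mem_iota /entry_on /=; lia.
Qed.

Lemma g3n1_coef_2 k : (3 <= k <= 4)%N -> graded_coef K (G3n1 n) k 2 = 1.
Proof.
move=> k_in; rewrite /graded_coef ifT /=; last by lia.
rewrite ifF; last by lia.
rewrite ifF; last by lia.
rewrite !table_coef_cat table_coef_map0 ?add0r.
  rewrite (@table_coef_map1 _ _ _ k.-1) ?iota_uniq ?mem_iota//=; try lia.
    by rewrite table_coef_map0 ?addr0// => i; rewrite mem_iota /entry_on /=; lia.
  by move=> i; rewrite mem_iota /entry_on /=; lia.
by move=> i; rewrite mem_iota /entry_on /=; lia.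
Qed.

(** This is [e_2, e_3] = e_6, from the third block, which is nonempty exactly when n >= 7. *)
Lemma g3n1_coef_34 : graded_coef K (G3n1 n) 3 4 = 1.
Proof.
rewrite /graded_coef ifT /=; last by lia.
rewrite !table_coef_cat table_coef_map0 ?add0r.
  rewrite table_coef_map0 ?add0r.
    rewrite (@table_coef_map1 _ _ _ 3) ?iota_uniq ?mem_iota//=; try lia.
    by move=> i; rewrite mem_iota /entry_on /=; lia.
  by move=> i; rewrite mem_iota /entry_on /=; lia.
by move=> i; rewrite mem_iota /entry_on /=; lia.
Qed.

End CoefficientsG3n1.

(** A finite computation once the sum is unlocked; the last value is the sign (-1)^2 in
    [e_2, e_5]. *)
Lemma g1_7_coefs (K : numFieldType) :
  [/\ forall k, (2 <= k <= 7 - 2)%N -> graded_coef K G1_7 1 k = 1,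
      graded_coef K G1_7 2 3 = 1 & graded_coef K G1_7 2 (7 - 2) = 1].
Proof.
rewrite /graded_coef /table_coef unlock; split.
- by do 6?[case=> //]; move=> //= *; rewrite ?(addr0, add0r).
- by rewrite /= !(addr0, add0r).
by rewrite /= sqrrN expr1n !(addr0, add0r).
Qed.

Lemma g2_9_coefs (K : numFieldType) :
  [/\ forall k, (2 <= k <= 9 - 2)%N -> graded_coef K G2_9 1 k = 1,
      graded_coef K G2_9 2 3 = 1 & graded_coef K G2_9 2 (9 - 2) = 1].
Proof.
rewrite /graded_coef /table_coef unlock; split.
- by do 8?[case=> //]; move=> //= *; rewrite ?(addr0, add0r).
- by rewrite /= !(addr0, add0r).
by rewrite /= sqrrN expr1n !(addr0, add0r).
Qed.

Lemma g3_11_coefs (K : numFieldType) :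
  [/\ forall k, (2 <= k <= 11 - 2)%N -> graded_coef K G3_11 1 k = 1,
      graded_coef K G3_11 2 3 = 1 & graded_coef K G3_11 2 (11 - 2) = 1].
Proof.
rewrite /graded_coef /table_coef unlock; split.
- by do 10?[case=> //]; move=> //= *; rewrite ?(addr0, add0r).
- by rewrite /= !(addr0, add0r).
by rewrite /= sqrrN expr1n !(addr0, add0r).
Qed.

(** The first family falls under the criterion with three generators, because e_n, of weight 2,
    commutes with e_1; the other algebras are generated in weights 1 and 2. *)
Lemma graded_coef_rigid (K : numFieldType) g : nilalg_ok g ->
  derivations_diagonal (nildim g) (graded_coef K g) /\
  noncentral_or_product (nildim g) (graded_coef K g).
Proof.
move=> g_ok; have anti p q := graded_coef_anti K p q g_ok.
case: g g_ok anti => [n n_ge7||| ] /=.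
- move=> anti; have c1 := @g3n1_coef_1 K n n_ge7.
  have c32 : graded_coef K (G3n1 n) 3 2 = 1 by exact: g3n1_coef_2.
  split; last exact: three_generators_central.
  apply: three_generators_diagonal => //.
  + exact: g3n1_coef_12.
  + exact: g3n1_coef_2.
  + exact: g3n1_coef_34.
- move=> _ anti; have [c1 c23 c25] := g1_7_coefs K.
  by split; [apply: two_generators_diagonal | apply: two_generators_central].
- move=> _ anti; have [c1 c23 c27] := g2_9_coefs K.
  by split; [apply: two_generators_diagonal | apply: two_generators_central].
move=> _ anti; have [c1 c23 c29] := g3_11_coefs K.
by split; [apply: two_generators_diagonal | apply: two_generators_central].
Qed.

(** * Passage between the given tables and the indexing by weight *)

Lemma perm_iota_inj (m : nat) (s r : nat -> nat) :
  (forall i, (0 < i <= m)%N -> (0 < s i <= m)%N) ->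
  (forall i, (0 < i <= m)%N -> (0 < r i <= m)%N) ->
  (forall i, (0 < i <= m)%N -> r (s i) = i) ->
  (forall i, (0 < i <= m)%N -> s (r i) = i) ->
  perm_eq [seq s i | i <- iota 1 m] (iota 1 m).
Proof.
move=> s_in r_in sK rK.
have memE i : (i \in iota 1 m) = (0 < i <= m)%N by rewrite mem_iota add1n ltnS.
apply: uniq_perm; rewrite ?iota_uniq//.
  rewrite map_inj_in_uniq ?iota_uniq// => i j; rewrite !memE => i_in j_in.
  by move/(congr1 r); rewrite !sK.
move=> i; rewrite memE; apply/mapP/idP => [[j]|i_in].
  by rewrite memE => /s_in j_in ->.
by exists (r i); rewrite ?memE ?r_in ?rK.
Qed.

Unset Implicit Arguments.

Theorem theorem3p6 (R : realType) (V : vectType R[i]) (br : V -> V -> V)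
  (g : nilalg) (N : {vspace V}) :
  nilalg_ok g ->
  leibniz_algebra br ->
  solvable_alg br ->
  nilradical br N ->
  (exists e0 : nat -> V, has_table_basis br N (nildim g) (nil_table _ g) e0) ->
  \dim (fullv : {vspace V}) = (\dim N).+1 ->
  exists (e : nat -> V) (x : V),
    [/\ basis_of fullv (rcons [seq e i | i <- iota 1 (nildim g)] x),
        has_table_basis br N (nildim g) (nil_table _ g) e,
        (forall i, (1 <= i <= nildim g)%N ->
           br (e i) x = x_weight _ g i *: e i /\
           br x (e i) = - (x_weight _ g i *: e i)) &
        br x x = 0].
Proof.
move=> g_ok brL _ nilN [e0 [e0B e0_br]] dimV.
pose m := nildim g; pose c := graded_coef R[i] g.
pose f k := if (0 < k <= m)%N then e0 (unweight g k) else 0.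
have f_out k : ~~ (0 < k <= m)%N -> f k = 0 by rewrite /f => /negPf->.
have f_weight k : (0 < k <= m)%N -> e0 k = f (weight g k).
  by move=> k_in; rewrite /f weight_range// weightK.
have w_in := @weight_range g ^~ g_ok; have u_in := @unweight_range g ^~ g_ok.
have wK := @weightK g ^~ g_ok; have uK := @unweightK g ^~ g_ok.
have fB : basis_of N [seq f k | k <- iota 1 m].
  rewrite -(perm_basis N (perm_map e0 (perm_iota_inj u_in w_in uK wK))) in e0B.
  rewrite -map_comp in e0B; congr (basis_of N _): e0B; apply/eq_in_map => k.
  by rewrite mem_iota add1n ltnS /f => ->.
have brf p q : br (f p) (f q) = c p q *: f (p + q)%N.
  (* Out of range, either a factor is 0 by the definition of [f], or p + q > m and the table
     coefficient vanishes. *)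
  have [pq_in|pq_out] := boolP [&& 0 < p, 0 < q & p + q <= m]%N; last first.
    rewrite /c /graded_coef (negPf pq_out) scale0r /f.
    have [p_in|_] := ifP; last exact: br0l brL _.
    have [q_in|_] := ifP; last exact: br0r brL _.
    rewrite !e0_br ?u_in//.
    rewrite (table_br_graded _ _ (nil_table_graded _ g_ok) f_weight).
    rewrite table_coef_weight ?u_in// !uK// /graded_coef.
    by rewrite (negPf pq_out) scale0r.
  rewrite /f !ifT; [|lia..].
  rewrite e0_br ?u_in//; [|lia..].
  rewrite (table_br_graded _ _ (nil_table_graded _ g_ok) f_weight).
  rewrite table_coef_weight ?u_in// ?uK//; [|lia..].
  by rewrite /f ifT//; lia.
have [diag central] := graded_coef_rigid R[i] g_ok.
have [f' [x [[f'B Nx] f'_out brf' f'x xx]]] :=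
  graded_extension brL nilN dimV (@graded_coef_supp _ g)
    (fun p q => graded_coef_anti R[i] p q g_ok) central diag fB f_out brf.
(* Composing with [weight] restores the original numbering; on bases this is a permutation. *)
have eB : basis_of N [seq f' (weight g i) | i <- iota 1 m].
  rewrite -(perm_basis N (perm_map f' (perm_iota_inj w_in u_in wK uK))) in f'B.
  by rewrite -map_comp in f'B.
exists (f' \o weight g), x; split=> //.
- rewrite (perm_basis _ (introT permPl (perm_rcons x _))) basisEfree free_cons subvf /=.
  rewrite (span_basis eB) Nx (basis_free eB) /=.
  by rewrite dimV size_map size_iota (size_basis fB).
- split=> // i j i_in j_in.
  rewrite (table_br_graded _ _ (nil_table_graded _ g_ok) (f := f'))//= brf'.
  by rewrite table_coef_weight.
- move=> i i_in; have [fx xf] := f'x (weight g i).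
  (* The prescribed eigenvalue of e_i is its weight, viewed as a scalar. *)
  have <- : (weight g i)%:R = x_weight R[i] g i.
    by rewrite /weight /x_weight; case: (g) => // n; do 2?case: ifP.
  by [].
Qed.
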